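(* Let $p$ be a prime and $\alpha\in\mathbb{N}$, let $G=\mathbb{Z}/p^{\alpha}\mathbb{Z}$, let $\Gamma(G)$ be the group-annihilator graph of $G$, and let $L(\Gamma(G))$ be its Laplacian matrix. Then $p^{\alpha},p^{\alpha-1},\dots,p,1$ are eigenvalues of $L(\Gamma(G))$.
   Context: For a finite abelian group $G$ viewed as a $\mathbb{Z}$-module and $x\in G$, $[x:G]=\{r\in\mathbb{Z} : rG\subseteq\mathbb{Z}x\}$. The group-annihilator graph $\Gamma(G)$ has vertex set $G$, with distinct $x,y$ adjacent iff $[x:G][y:G]G=\{0\}$ (product of ideals of $\mathbb{Z}$). The Laplacian matrix is $L=D-A$, where $A$ is the adjacency matrix and $D$ the diagonal matrix of vertex degrees.
   Formalization: The formal theorem assumes α ≥ 1 and excludes p = 2 with α = 1 or 2, where the claim fails: Γ(Z/2) = K_2 has Laplacian spectrum {0, 2}, lacking 1, and Γ(Z/4) = K_{1,3} has spectrum {0, 1, 1, 4}, lacking 2. *)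

(* Defs.v *)
From HB Require Import structures.
From mathcomp Require Import all_boot all_order all_algebra.
From mathcomp Require Import boolp classical_sets.

Set Implicit Arguments.
Unset Strict Implicit.
Unset Printing Implicit Defensive.

Import Order.TTheory GRing.Theory Num.Theory.
Local Open Scope classical_set_scope.
Local Open Scope ring_scope.

(* Simple graphs are symmetric irreflexive relations [e : rel T]; the rows and
   columns of their matrices are indexed through the enumeration of [T]. *)
Section GraphMatrices.
Variables (R : nzRingType) (T : finType) (e : rel T).

Definition adjacency_mx : 'M[R]_#|T| :=
  \matrix_(i, j) (e (enum_val i) (enum_val j))%:R.

Definition degree (x : T) : nat := #|[pred y | e x y]|.

Definition degree_mx : 'M[R]_#|T| :=
  diag_mx (\row_i (degree (enum_val i))%:R).

Definition laplacian_mx : 'M[R]_#|T| := degree_mx - adjacency_mx.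

End GraphMatrices.

Section GroupAnnihilator.
Variable G : finZmodType.

(* The Z-module structure of [G] is [g *~ r]; this ideal is written [x : G]. *)
Definition colon_ideal (x : G) : set int :=
  [set r | range (fun g : G => g *~ r) `<=` range (fun n : int => x *~ n)].

(* The product of ideals of Z consists of all finite sums of products. *)
Definition ideal_mul (I J : set int) : set int :=
  [set t | exists2 s : seq (int * int),
     forall u, u \in s -> I u.1 /\ J u.2 & t = \sum_(u <- s) u.1 * u.2].

(* The submodule I G consists of all finite sums of elements r g, r in I. *)
Definition ideal_act (I : set int) : set G :=
  [set h | exists2 s : seq (int * G),
     forall u, u \in s -> I u.1 & h = \sum_(u <- s) u.2 *~ u.1].

(* [x : G] is a set of integers, so adjacency is decided classically. *)
Definition group_annihilator_graph : rel G := fun x y =>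
  (x != y) &&
  `[< ideal_act (ideal_mul (colon_ideal x) (colon_ideal y)) = [set 0] >].

End GroupAnnihilator.

(* Main.v *)
(* In Z/n the ideal [x : G] is the preimage of the ideal generated by x, so
   distinct x and y are adjacent iff x * y = 0; a loop at x would not change the
   Laplacian, so (L f)(x) is the sum of f x - f y over all y with x * y = 0.
   Let n = p ^ alpha, u = p ^ k and let c be a unit with c * u <> u.  Since u and
   c * u have the same annihilator, of order p ^ k, the difference of their
   indicator functions is an eigenfunction for p ^ k.  There is no such c in two
   cases.  If k = alpha, then n times the indicator of 0, minus 1, works because
   the vertex 0 dominates the graph.  If p = 2 and k = alpha - 1, write n = 2 m:
   after deleting 0, the nonzero even elements form a component dominated by m,
   and the same construction on this component, extended by 0, works. *)
Require Import Defs.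
From mathcomp Require Import all_boot all_order all_algebra.
From mathcomp Require Import boolp classical_sets ring zify.

Set Implicit Arguments.
Unset Strict Implicit.
Unset Printing Implicit Defensive.

Import Order.TTheory GRing.Theory Num.Theory.
Local Open Scope ring_scope.

(** [eigenvalue] asks for a row vector [v] with [v *m L = a *: v]; since [e] is symmetric, this is
    the equation [L f = a f] on functions. *)
Lemma eigenvalue_laplacian (R : fieldType) (T : finType) (e : rel T)
    (f : T -> R) (a : R) (x0 : T) :
  symmetric e -> f x0 != 0 ->
  (forall x, \sum_(y | e x y) (f x - f y) = a * f x) ->
  eigenvalue (laplacian_mx R e) a.
Proof.
move=> e_sym fx0 fP; apply/eigenvalueP; exists (\row_j f (enum_val j)).
  apply/rowP=> j; rewrite mulmxBr mul_mx_diag !mxE -fP sumrB sumr_const.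
  rewrite mulr_natr; congr (_ - _).
  rewrite [RHS]big_mkcond [RHS](reindex (@enum_val T T)) /=; last first.
    exact/onW_bij/enum_val_bij.
  apply: eq_bigr => i _.
  by rewrite !mxE e_sym; case: (e _ _); rewrite ?mulr1 ?mulr0.
apply: contraNneq fx0 => /rowP/(_ (enum_rank x0)).
by rewrite !mxE enum_rankK => ->.
Qed.

(** Since [1] generates the group, only [1 *~ r] needs testing, and the integer multiples of [x] are
    exactly its ring multiples. *)
Lemma colon_idealP (n : nat) (x : 'Z_n) (r : int) :
  colon_ideal x r <-> exists c : 'Z_n, r%:~R = x * c.
Proof.
split=> [/(_ (1 *~ r)) [|m _ xm]|[c rE] _ [g _ <-]].
- by exists 1.
- by exists m%:~R; rewrite -xm mulrzr.
exists (val (c * g))%:Z => //.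
by rewrite -mulrzr -pmulrn natr_Zp -mulrzr rE mulrA mulrC.
Qed.

(** The representative of [x] lies in [[x : G]], so adjacency forces [x * y = 0]; conversely,
    products from the two ideals become multiples of [x * y] in ['Z_n]. *)
Lemma group_annihilator_graphE (n : nat) (x y : 'Z_n) :
  group_annihilator_graph x y = (x != y) && (x * y == 0).
Proof.
rewrite /group_annihilator_graph; congr (_ && _).
apply/asboolP/eqP => [xy0|xy0].
  suff: ideal_act (ideal_mul (colon_ideal x) (colon_ideal y)) (x * y).
    by rewrite xy0.
  have colon_val (z : 'Z_n) : colon_ideal z (val z)%:Z.
    by apply/colon_idealP; exists 1; rewrite mulr1 -pmulrn natr_Zp.
  exists [:: ((val x)%:Z * (val y)%:Z, 1)].
    move=> _ /[!inE] /eqP -> /=.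
    exists [:: ((val x)%:Z, (val y)%:Z)]; last by rewrite big_seq1.
    by move=> _ /[!inE] /eqP ->; split; apply: colon_val.
  by rewrite big_seq1 /= intrM -!pmulrn !natr_Zp.
apply/seteqP; split=> [_ [s sP ->]|_ ->]; last first.
  by exists [::] => //; rewrite big_nil.
rewrite /= big_seq big1 // => u /sP [t tP ->].
rewrite -mulrzr rmorph_sum /= big_seq big1 ?mulr0 // => w /tP.
move=> [/colon_idealP [c cE] /colon_idealP [d dE]].
by rewrite intrM cE dE mulrACA xy0 mul0r.
Qed.

Lemma eigenvalue_annihilator (R : fieldType) (n : nat)
    (f : 'Z_n -> R) (a : R) (x0 : 'Z_n) :
  f x0 != 0 ->
  (forall x, \sum_(y | x * y == 0) (f x - f y) = a * f x) ->
  eigenvalue (laplacian_mx R (@group_annihilator_graph 'Z_n)) a.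
Proof.
move=> fx0 fP; apply: (eigenvalue_laplacian (f := f) (x0 := x0)) => //.
  by move=> x y; rewrite !group_annihilator_graphE eq_sym mulrC.
move=> x; rewrite -fP big_mkcond [RHS]big_mkcond; apply: eq_bigr => y _.
rewrite group_annihilator_graphE; case: eqVneq => //= ->.
by rewrite subrr if_same.
Qed.

Lemma sum_delta (R : pzSemiRingType) (T : finType) (P : pred T) (u : T) :
  \sum_(y | P y) (y == u)%:R = (P u)%:R :> R.
Proof.
rewrite big_mkcond (bigD1 u) //= eqxx big1 ?addr0; first by case: (P u).
by move=> y /negPf ->; rewrite if_same.
Qed.

Lemma eigenvalue_annihilator_order (R : numFieldType) (n : nat) (n_gt1 : (1 < n)%N) :
  eigenvalue (laplacian_mx R (@group_annihilator_graph 'Z_n)) n%:R.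
Proof.
have cardZ : #|'Z_n| = n by rewrite card_ord Zp_cast.
pose f (x : 'Z_n) : R := n%:R * (x == 0)%:R - 1.
apply: (eigenvalue_annihilator (f := f) (x0 := 1)).
  by rewrite /f oner_eq0 mulr0 sub0r oppr_eq0 oner_eq0.
move=> x; rewrite /f sumrB sumr_const sumrB -mulr_sumr sum_delta mulr0 eqxx.
rewrite sumr_const.
(* For [x != 0] one has [f x = -1], and the size of the annihilator of [x] cancels. *)
have [->|x_neq0] := eqVneq x 0; last first.
  by rewrite -[(_ - 1) *+ _]mulr_natr /=; ring.
rewrite (eq_card (B := 'Z_n)) ?cardZ; last by move=> y; apply/eqP/mul0r.
by rewrite -[(_ - 1) *+ _]mulr_natr /=; ring.
Qed.

Lemma eigenvalue_annihilator_unit (R : numFieldType) (n : nat) (u c : 'Z_n) :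
  c \is a GRing.unit -> c * u != u ->
  eigenvalue (laplacian_mx R (@group_annihilator_graph 'Z_n))
             #|[pred y | u * y == 0]|%:R.
Proof.
move=> c_unit cu_neq.
pose f (x : 'Z_n) : R := (x == u)%:R - (x == c * u)%:R.
apply: (eigenvalue_annihilator (f := f) (x0 := u)).
  by rewrite /f eqxx [u == _]eq_sym (negPf cu_neq) subr0 oner_eq0.
have annE y : (c * u * y == 0) = (u * y == 0).
  by rewrite -mulrA -(inj_eq (mulrI c_unit) (u * y) 0) mulr0.
(* By [annE], [f] sums to 0 over the annihilator of any [x]; what remains is [f x] times the size of
   that annihilator. *)
move=> x; rewrite /f sumrB sumr_const sumrB !sum_delta.
rewrite [x * (c * u)]mulrC annE [u * x]mulrC subrr subr0 -[LHS]mulr_natl.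
have [->|x_neq_u] := eqVneq x u; first by [].
have [->|] := eqVneq x (c * u); last by rewrite subrr !mulr0.
by rewrite (eq_card (B := [pred y | u * y == 0])) // => y; rewrite !inE annE.
Qed.

(** The modulus of ['Z_n] is [(Zp_trunc n).+2], which is [n] only when [1 < n]. *)
Lemma Zp_mul_eq0 (n : nat) (x y : 'Z_n) :
  (1 < n)%N -> (x * y == 0) = (n %| x * y)%N.
Proof. by move=> n_gt1; rewrite -val_eqE /= [X in (_ %% X)%N]Zp_cast. Qed.

Lemma ltn_Zp (n : nat) (x : 'Z_n) : (1 < n)%N -> (x < n)%N.
Proof. by move=> n_gt1; rewrite -[X in (_ < X)%N](Zp_cast n_gt1). Qed.

(** With [n = e * d], the annihilator of [d] consists of the multiples [e * i] with [i < d]. *)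
Lemma card_annihilator_divisor (n d : nat) :
  (1 < n)%N -> (d %| n)%N -> #|[pred y : 'Z_n | d%:R * y == 0]| = d.
Proof.
move=> n_gt1 /dvdnP [e nE].
have [e_gt0 d_gt0] : (0 < e)%N /\ (0 < d)%N by lia.
pose h (i : 'I_d) : 'Z_n := (e * i)%:R.
have hE i : h i = (e * i)%N :> nat.
  by rewrite /h val_Zp_nat // modn_small // nE ltn_pmul2l.
have h_inj : injective h.
  move=> i j /(congr1 val) /=; rewrite !hE => /eqP.
  by rewrite eqn_pmul2l // => /eqP /val_inj.
rewrite -[RHS]card_ord -(card_codom h_inj); apply: eq_card => y.
rewrite !inE -[y in LHS]natr_Zp -natrM -val_eqE /= val_Zp_nat //.
have -> : (((d * y) %% n)%N == 0%N) = (e %| y)%N.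
  by rewrite -/(dvdn n _) [X in (X %| _)%N]nE (mulnC e) dvdn_pmul2l.
apply/idP/codomP => [/dvdnP [i yE]|[i ->]]; last by rewrite hE dvdn_mulr.
have i_lt : (i < d)%N.
  have := ltn_Zp y n_gt1; rewrite yE [X in (_ < X)%N]nE mulnC.
  by rewrite ltn_pmul2l.
by exists (Ordinal i_lt); apply: val_inj; rewrite /= hE yE mulnC.
Qed.

Lemma eigenvalue_annihilator_2power (R : numFieldType) (b : nat) :
  (1 < b)%N ->
  eigenvalue (laplacian_mx R (@group_annihilator_graph 'Z_(2 ^ b.+1)))
             (2 ^ b)%:R.
Proof.
move=> b_gt1; set n := (2 ^ b.+1)%N; set m := (2 ^ b)%N.
have nE : n = (2 * m)%N by rewrite /n expnS.
have m_ge4 : (4 <= m)%N by rewrite (@leq_pexp2l 2 2 b).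
have n_gt1 : (1 < n)%N by lia.
have m_even : ~~ odd m by rewrite /m oddX; lia.
pose u : 'Z_n := m%:R.
have uE : u = m :> nat by rewrite /u val_Zp_nat // modn_small; lia.
have u_neq0 : (u == 0) = false by rewrite -val_eqE /= uE; lia.
have u_ann (y : 'Z_n) : (u * y == 0) = ~~ odd y.
  by rewrite Zp_mul_eq0 // uE [X in (X %| _)%N]nE mulnC dvdn_pmul2l ?dvdn2 //; lia.
have odd_ann (x y : 'Z_n) : odd x -> (x * y == 0) = (y == 0).
  move=> x_odd; rewrite Zp_mul_eq0 // Gauss_dvdr ?coprimeXl ?coprime2n //.
  by rewrite /dvdn modn_small ?ltn_Zp.
(* [f] is m - 2 at [u], -1 at the other nonzero even elements and 0 elsewhere. *)
pose f (x : 'Z_n) : R := (m%:R - 1) * (x == u)%:R - (~~ odd x)%:R + (x == 0)%:R.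
apply: (eigenvalue_annihilator (f := f) (x0 := u)).
  (* [f u = m - 2] is nonzero because [m] is at least 4. *)
  rewrite /f eqxx u_neq0 uE m_even mulr1 addr0 -addrA -opprD -(natrD _ 1 1).
  by rewrite subr_eq0 eqr_nat; lia.
have cardu : #|[pred y : 'Z_n | ~~ odd y]| = m.
  rewrite -[RHS](@card_annihilator_divisor n m) ?nE ?dvdn_mull // -?nE //.
  by apply: eq_card => y; rewrite !inE u_ann.
move=> x; rewrite sumrB sumr_const big_split /= sumrB -mulr_sumr !sum_delta.
rewrite mulr0 eqxx [x * u]mulrC u_ann.
have [x_odd|x_even] := boolP (odd x).
  have -> : f x = 0.
    rewrite /f x_odd; have [xu|_] := eqVneq x u.
      by move: x_odd; rewrite xu uE (negPf m_even).
    have [x0|_] := eqVneq x 0; first by move: x_odd; rewrite x0.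
    by rewrite mulr0 subr0 addr0.
  (* An odd [x] is annihilated only by 0, where [f] vanishes. *)
  rewrite (eq_bigl (fun y => y == 0)); last by move=> y; rewrite odd_ann.
  by rewrite big_pred1_eq /= mul0rn !mulr0; ring.
have sum_even : \sum_(y | ~~ odd (y : 'Z_n)) (~~ odd y)%:R = m%:R :> R.
  rewrite -cardu -sumr_const; apply: eq_bigr => y.
  by rewrite ?inE => ->.
(* At 0 the sum runs over all vertices, and the values of [f] add up to [(m - 1) - m + 1 = 0]. *)
have [x0|x_neq0] := eqVneq x 0.
  have -> : f x = 0 by rewrite /f x0 eq_sym u_neq0 eqxx /=; ring.
  rewrite x0 (eq_bigl xpredT); last by move=> y; rewrite mul0r eqxx.
  rewrite (bigID (fun y : 'Z_n => ~~ odd y)) /= sum_even big1 => [|y /negbNE -> //].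
  by rewrite mul0rn; ring.
have fxE : f x = (m%:R - 1) * (x == u)%:R - 1.
  rewrite /f x_even (negPf x_neq0) /=.
  by case: (x == u) => /=; ring.
have ann_even (y : 'Z_n) : x * y == 0 -> ~~ odd y.
  by apply: contraL => y_odd; rewrite mulrC odd_ann.
rewrite (eq_bigr (fun=> 1)) => [|y /ann_even ->] //.
rewrite sumr_const fxE -[(_ - 1) *+ _]mulr_natr.
(* Away from [u], [f x = -1] and the size of the annihilator cancels; at [u] this size is [m]. *)
have [xu|_] := eqVneq x u; last by rewrite /=; ring.
rewrite (eq_card (B := [pred y : 'Z_n | ~~ odd y])) ?cardu; first by rewrite /=; ring.
by move=> y; rewrite xu; apply: u_ann.
Qed.

(** Cancelling [p ^ k] turns [c * p ^ k = p ^ k] modulo [p ^ alpha] into divisibility of [c - 1] by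
    [p ^ (alpha - k)]. *)
Lemma Zp_unit_mul_neq (p alpha k c : nat) :
  prime p -> (k < alpha)%N -> (0 < c)%N -> ~~ (p %| c)%N ->
  ~~ (p ^ (alpha - k) %| c.-1)%N ->
  (c%:R : 'Z_(p ^ alpha)) \is a GRing.unit /\
  c%:R * (p ^ k)%:R != (p ^ k)%:R :> 'Z_(p ^ alpha).
Proof.
move=> p_prime k_lt c_gt0 p_ndvd.
have n_gt1 : (1 < p ^ alpha)%N.
  by rewrite -(exp1n alpha) ltn_exp2r ?prime_gt1 //; lia.
rewrite unitZpE // coprimeXl ?prime_coprime // => c_ndvd; split=> //.
apply: contra c_ndvd; rewrite -natrM -val_eqE /= !val_Zp_nat //.
rewrite eqn_mod_dvd ?leq_pmull //.
rewrite -[X in (_ - X)%N]mul1n -mulnBl subn1 -(subnK (ltnW k_lt)) expnD.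
by rewrite dvdn_pmul2r ?expn_gt0 ?prime_gt0 // addnK.
Qed.

Theorem theorem10 (R : numFieldType) (p alpha : nat)
    (p_prime : prime p) (alpha_gt0 : (0 < alpha)%N)
    (nondegenerate : (2 < p)%N \/ (2 < alpha)%N)
    (k : nat) (k_le_alpha : (k <= alpha)%N) :
  eigenvalue (laplacian_mx R (@group_annihilator_graph 'Z_(p ^ alpha)))
             (p ^ k)%:R.
Proof.
have p_gt1 := prime_gt1 p_prime.
have n_gt1 : (1 < p ^ alpha)%N by rewrite -(exp1n alpha) ltn_exp2r.
have [k_lt|k_ge] := ltnP k alpha; last first.
  have -> : k = alpha by lia.
  exact: eigenvalue_annihilator_order.
have from_unit c : (0 < c)%N -> ~~ (p %| c)%N ->
    ~~ (p ^ (alpha - k) %| c.-1)%N ->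
    eigenvalue (laplacian_mx R (@group_annihilator_graph 'Z_(p ^ alpha)))
               (p ^ k)%:R.
  move=> c_gt0 p_ndvd c_ndvd.
  have [c_unit c_neq] := Zp_unit_mul_neq p_prime k_lt c_gt0 p_ndvd c_ndvd.
  have := eigenvalue_annihilator_unit R c_unit c_neq.
  by rewrite card_annihilator_divisor ?dvdn_exp2l.
have [p_gt2|p_le2] := ltnP 2 p.
  (* Here [c - 1 = 1], and [alpha - k] is positive. *)
  apply: (from_unit 2%N) => //; first by rewrite gtnNdvd.
  by rewrite dvdn1 -(expn0 p) eqn_exp2l //; lia.
have p2 : p = 2%N by lia.
have [k_lt1|k_ge] := ltnP k.+1 alpha.
  (* Here [c - 1 = 2], while [alpha - k] is at least 2. *)
  apply: (from_unit 3%N); rewrite ?p2 //=.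
  by rewrite -[X in (_ %| X)%N](expn1 2) dvdn_Pexp2l //; lia.
(* With [p = 2], [nondegenerate] leaves [2 < alpha], hence [1 < k]. *)
have [alphaE k_gt1] : alpha = k.+1 /\ (1 < k)%N by lia.
by rewrite p2 alphaE; apply: eigenvalue_annihilator_2power.
Qed.
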